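(* Let $n \ge 2$ be an integer, let $S_n$ be the set of permutations of $\{1,\dots,n\}$, and equip $S_n$ with the swap neighborhood $N$. Let $(\psi_{ijpq})_{i,j,p,q=1}^{n}$ be an arbitrary family of real numbers, and define $f : S_n \to \mathbb{R}$ by $f(x) = \sum_{i,j,p,q=1}^{n} \psi_{ijpq}\, \delta_{x(i)}^{p}\, \delta_{x(j)}^{q}$. Then $f$ is the sum of at most three elementary landscapes with characteristic constants $k_1 = 2n$, $k_2 = 2(n-1)$ and $k_3 = n$; that is, there exist functions $f_1,f_2,f_3 : S_n \to \mathbb{R}$ with $f = f_1+f_2+f_3$ such that, for each $m \in \{1,2,3\}$, $(S_n,N,f_m)$ is an elementary landscape with characteristic constant $k_m$.
   Context: This covers the Quadratic Assignment Problem cost $f(x)=\sum_{i,j=1}^n r_{ij} w_{x(i)x(j)}$ as the special case $\psi_{ijpq} = r_{ij}w_{pq}$. $\delta$ denotes the Kronecker delta. Swap neighborhood: for $x \in S_n$, $N(x)$ is the set of permutations obtained from $x$ by exchanging the values at two distinct positions, i.e. $y \in N(x)$ iff $y = x \circ \tau$ for a transposition $\tau$ of $\{1,\dots,n\}$; thus $|N(x)| = d = n(n-1)/2$ for every $x$. For $g : S_n \to \mathbb{R}$ write $\bar g = \frac{1}{n!}\sum_{x \in S_n} g(x)$ and $\langle g \rangle_{N(x)} = \frac{1}{d}\sum_{y \in N(x)} g(y)$. The landscape $(S_n,N,g)$ is elementary with characteristic constant $k$ if for every $x \in S_n$, $\langle g \rangle_{N(x)} = g(x) + \frac{k}{d}\left(\bar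 g - g(x)\right)$. *)

(* Defs.v *)
From HB Require Import structures.
From mathcomp Require Import all_boot all_order all_fingroup all_algebra.
From mathcomp Require Import reals.

Set Implicit Arguments.
Unset Strict Implicit.
Unset Printing Implicit Defensive.

Import GRing.Theory.
Local Open Scope ring_scope.

(* ['S_n] is the group of permutations of [{0, ..., n-1}].  The group law of
   MathComp composes from left to right, so [tperm i j * x] is [x \o tperm i j]
   (the values of [x] at the positions [i] and [j] are exchanged). *)
Definition swap_nbhd (n : nat) (x : 'S_n) : {set 'S_n} :=
  [set y | [exists i : 'I_n, exists j : 'I_n,
              (i != j) && (y == (tperm i j * x)%g)]].

Definition swap_degree (n : nat) : nat := ((n * (n - 1)) %/ 2)%N.

Lemma card_swap_nbhd (n : nat) (x : 'S_n) : #|swap_nbhd x| = swap_degree n.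
Proof.
pose P := [set p : 'I_n * 'I_n | (p.1 < p.2)%N].
pose h (p : 'I_n * 'I_n) : 'S_n := (tperm p.1 p.2 * x)%g.
have -> : swap_nbhd x = h @: P.
  apply/setP=> y; rewrite inE; apply/existsP/imsetP.
    case=> i /existsP[j /andP[nij /eqP ->]].
    case: (ltngtP i j) => [lt_ij|lt_ji|/val_inj eq_ij].
    - by exists (i, j); rewrite ?inE.
    - by exists (j, i); rewrite ?inE // /h /= tpermC.
    - by rewrite eq_ij eqxx in nij.
  case=> -[i j]; rewrite inE /= => lt_ij ->.
  exists i; apply/existsP; exists j; rewrite eqxx andbT.
  by apply: contraTneq lt_ij => ->; rewrite ltnn.
rewrite card_in_imset; last first.
  move=> [i j] [k l]; rewrite !inE /h /= => lt_ij lt_kl /mulIg e.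
  have ei : tperm k l i = j by rewrite -e tpermL.
  have ej : tperm k l j = i by rewrite -e tpermR.
  move: ei ej lt_ij; case: tpermP => [-> <- | -> <- | _ _ ->].
  - by [].
  - by move=> _ /ltnW; rewrite leqNgt lt_kl.
  - by move=> _; rewrite ltnn.
rewrite /swap_degree subn1 divn2 -bin2 -bin2_sum big_mkord.
rewrite cardsE -sum1_card (eq_bigl (fun p : 'I_n * 'I_n => true && (p.1 < p.2)%N)) //.
rewrite -(pair_big_dep xpredT (fun i j : 'I_n => i < j)%N (fun _ _ => 1%N)) /=.
rewrite (exchange_big_dep xpredT) //=; apply: eq_bigr => j _.
rewrite sum1_card -[RHS]card_ord.
have inj_w : injective (widen_ord (ltnW (ltn_ord j))).
  by move=> a b /(congr1 val) /= /val_inj.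
rewrite -(card_imset _ inj_w).
apply: eq_card => i; apply/idP/imsetP => [lt_ij | [k _ ->]] /=.
  by exists (Ordinal lt_ij) => //; apply: val_inj.
exact: (ltn_ord k).
Qed.

Definition mean (R : realType) (n : nat) (g : 'S_n -> R) : R :=
  (\sum_(x : 'S_n) g x) / (n`!)%:R.

Definition nbhd_mean (R : realType) (n : nat) (g : 'S_n -> R) (x : 'S_n) : R :=
  (\sum_(y in swap_nbhd x) g y) / (swap_degree n)%:R.

Definition elementary (R : realType) (n : nat) (g : 'S_n -> R) (k : R) : Prop :=
  forall x : 'S_n,
    nbhd_mean g x = g x + k / (swap_degree n)%:R * (mean g - g x).

(* The Kronecker delta of [x i] and [p] is the boolean [x i == p] cast to [R]. *)
Definition gqap_cost (R : realType) (n : nat)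
    (psi : 'I_n -> 'I_n -> 'I_n -> 'I_n -> R) (x : 'S_n) : R :=
  \sum_(i < n) \sum_(j < n) \sum_(p < n) \sum_(q < n)
     psi i j p q * (x i == p)%:R * (x j == q)%:R.

(* Main.v *)
(* Let D be the graph Laplacian of the swap neighborhood, summed over ordered
   pairs of positions.  Functions g with D g = 2 k (g - c) for some constant c
   form a linear space, and they are elementary with constant k when k != 0,
   because D g always sums to zero.  With e_ip(x) = [x i = p], one finds
   D e_ip = 2 (n e_ip - 1), and for i != j, p != q, E = e_ip e_jq and its mirror
   image E' = e_iq e_jp,
     D E = 2 ((2n - 1) E - E' - e_ip - e_jq).
   Hence E - E' and E + E', corrected by multiples of the functions e_ip, have
   constants 2n and 2(n - 1), and the corrections have constant n. *)
Require Import Defs.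
From mathcomp Require Import all_boot all_order all_fingroup all_algebra.
From mathcomp Require Import reals ring.

Set Implicit Arguments.
Unset Strict Implicit.
Unset Printing Implicit Defensive.

Import GRing.Theory Num.Theory.
Local Open Scope ring_scope.

Section SwapLaplacian.
Variables (R : realType) (n : nat).
Implicit Types (f g : 'S_n -> R) (x : 'S_n) (i j a b p q : 'I_n).

(** * The swap Laplacian and its relation to neighborhood sums *)

Definition swap_laplacian g x : R :=
  \sum_a \sum_b (g x - g (tperm a b * x)%g).

Lemma swap_laplacianD f g x :
  swap_laplacian (fun y => f y + g y) x = swap_laplacian f x + swap_laplacian g x.
Proof.
rewrite -big_split; apply: eq_bigr => a _; rewrite -big_split.
by apply: eq_bigr => b _ /=; rewrite opprD addrACA.
Qed.

Lemma swap_laplacianZ (c : R) g x :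
  swap_laplacian (fun y => c * g y) x = c * swap_laplacian g x.
Proof.
rewrite mulr_sumr; apply: eq_bigr => a _; rewrite mulr_sumr.
by apply: eq_bigr => b _; rewrite mulrBr.
Qed.

(** Multiplication by a fixed transposition permutes ['S_n], so each pair [(a, b)] contributes
    zero. *)
Lemma sum_swap_laplacian g : \sum_x swap_laplacian g x = 0.
Proof.
rewrite exchange_big big1 // => a _; rewrite exchange_big big1 // => b _.
rewrite sumrB [X in _ - X](_ : _ = \sum_x g x) ?subrr //.
by rewrite [RHS](reindex_inj (mulgI (tperm a b))).
Qed.

(** Each neighbor arises from exactly one pair [a < b]: evaluating the transposition at the smaller
    of its two points recovers the pair. *)
Lemma sum_swap_nbhd g x :
  \sum_(y in swap_nbhd x) g y =
    \sum_(a : 'I_n) \sum_(b : 'I_n | (a < b)%N) g (tperm a b * x)%g.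
Proof.
pose P := [set p : 'I_n * 'I_n | (p.1 < p.2)%N].
pose h (p : 'I_n * 'I_n) : 'S_n := (tperm p.1 p.2 * x)%g.
have -> : swap_nbhd x = h @: P.
  apply/setP => y; rewrite inE; apply/existsP/imsetP => [[i /existsP[j]]|].
    case/andP=> nij /eqP ->; case: (ltngtP i j) => [lt_ij|lt_ji|/val_inj eq_ij].
    - by exists (i, j); rewrite ?inE.
    - by exists (j, i); rewrite ?inE // /h /= tpermC.
    - by rewrite eq_ij eqxx in nij.
  case=> -[i j]; rewrite inE /= => lt_ij ->.
  exists i; apply/existsP; exists j; rewrite eqxx andbT.
  by apply: contraTneq lt_ij => ->; rewrite ltnn.
rewrite big_imset /=; last first.
  move=> [i j] [k l]; rewrite !inE /h /= => lt_ij lt_kl /mulIg e.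
  have ei : tperm k l i = j by rewrite -e tpermL.
  move: ei lt_ij; case: tpermP => [-> <- // | -> <- | _ _ ->].
    by rewrite ltnNge ltnW.
  by rewrite ltnn.
rewrite (pair_big_dep xpredT (fun a b : 'I_n => a < b)%N) /=.
by apply: eq_bigl => p; rewrite inE.
Qed.

(** The factor 2 appears because every swap is counted as [(a, b)] and as [(b, a)], while the
    diagonal terms vanish. *)
Lemma swap_laplacian_nbhd g x :
  swap_laplacian g x =
    2 * ((swap_degree n)%:R * g x - \sum_(y in swap_nbhd x) g y).
Proof.
have -> : (swap_degree n)%:R * g x = \sum_(y in swap_nbhd x) g x.
  by rewrite sumr_const card_swap_nbhd mulr_natl.
rewrite -sumrB (sum_swap_nbhd (fun y => g x - g y)).
set h := fun a b => g x - g (tperm a b * x)%g.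
have split_lt a : \sum_b h a b =
    \sum_(b : 'I_n | (a < b)%N) h a b + \sum_(b : 'I_n | (b < a)%N) h a b.
  rewrite (bigID (fun b : 'I_n => a < b)%N) /=; congr (_ + _).
  rewrite (bigD1 a) ?ltnn //= {1}/h tperm1 mul1g subrr add0r.
  by apply: eq_bigl => b; rewrite -leqNgt ltn_neqAle andbC.
rewrite /swap_laplacian (eq_bigr _ (fun a _ => split_lt a)) big_split /=.
rewrite [X in _ + X](_ : _ =
    \sum_(a : 'I_n) \sum_(b : 'I_n | (a < b)%N) h a b); last first.
  rewrite (exchange_big_dep xpredT) //=.
  by do 2![apply: eq_bigr => ? _]; rewrite /h tpermC.
by rewrite mulrC mulr_natr mulr2n.
Qed.

(** * Eigenfunctions up to an additive constant *)

Definition shifted_eigen (k : R) g :=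
  exists c, forall x, swap_laplacian g x = 2 * k * (g x - c).

Lemma shifted_eigenD k f g : shifted_eigen k f -> shifted_eigen k g ->
  shifted_eigen k (fun x => f x + g x).
Proof.
move=> [c fc] [d gd]; exists (c + d) => x.
by rewrite swap_laplacianD fc gd; ring.
Qed.

Lemma shifted_eigenZ k (a : R) g :
  shifted_eigen k g -> shifted_eigen k (fun x => a * g x).
Proof.
move=> [c gc]; exists (a * c) => x.
by rewrite swap_laplacianZ gc; ring.
Qed.

Lemma shifted_eigen0 k : shifted_eigen k (fun=> 0).
Proof.
exists 0 => x; rewrite subr0 mulr0.
by rewrite /swap_laplacian big1 // => a _; rewrite big1 // => b _; rewrite subr0.
Qed.

Lemma elementary_shifted_eigen k g :
  (2 <= n)%N -> k != 0 -> shifted_eigen k g -> elementary g k.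
Proof.
move=> n2 k0 [c gc] x.
have d0 : (swap_degree n)%:R != 0 :> R.
  rewrite pnatr_eq0 /swap_degree -lt0n divn_gt0 //.
  by rewrite (leq_trans n2) // leq_pmulr // subn_gt0.
have two0 : 2 != 0 :> R by rewrite pnatr_eq0.
(* Summing the eigenvalue equation over all permutations gives [0] on the left; as [k] is nonzero,
   this forces [c] to be the mean. *)
have -> : mean g = c.
  have := sum_swap_laplacian g.
  rewrite (eq_bigr _ (fun x _ => gc x)) -mulr_sumr => /eqP.
  rewrite !mulf_eq0 (negPf two0) (negPf k0) sumrB subr_eq0 /= => /eqP sum_g.
  rewrite /mean sum_g sumr_const card_Sn -[c *+ _]mulr_natr mulfK //.
  by rewrite pnatr_eq0 -lt0n fact_gt0.
have := gc x; rewrite swap_laplacian_nbhd -mulrA => /(mulfI two0) e.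
rewrite /nbhd_mean -[X in X / _](subKr ((swap_degree n)%:R * g x)) e.
by field.
Qed.

(** * Sums over all transpositions of functions of one or two positions *)

Lemma sum_pred1_mul i (F : 'I_n -> R) : \sum_a (a == i)%:R * F a = F i.
Proof.
rewrite (bigD1 i) //= eqxx mul1r big1 ?addr0 // => a /negPf ->.
by rewrite mul0r.
Qed.

Lemma sum_pred1 (a : 'I_n) : \sum_p (a == p)%:R = 1 :> R.
Proof.
rewrite -[RHS](sum_pred1_mul a (fun=> 1)).
by apply: eq_bigr => p _; rewrite eq_sym mulr1.
Qed.

Lemma sum_tperm1 (F : 'I_n -> R) i :
  \sum_a \sum_b (F i - F (tperm a b i)) = 2 * (n%:R * F i - \sum_a F a).
Proof.
have sumB : \sum_b (F i - F b) = n%:R * F i - \sum_a F a.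
  by rewrite sumrB sumr_const card_ord mulr_natl.
(* Only swaps that involve [i] contribute; when [a = b = i] both summands are zero. *)
have H a b : F i - F (tperm a b i) =
    (a == i)%:R * (F i - F b) + (b == i)%:R * (F i - F a).
  case: tpermP => [<-|<-|/eqP/negPf nai /eqP/negPf nbi].
  - by rewrite eqxx; case: eqP => [->|_]; rewrite /=; ring.
  - by rewrite eqxx; case: eqP => [->|_]; rewrite /=; ring.
  - by rewrite (eq_sym a) (eq_sym b) nai nbi /=; ring.
under eq_bigr => a _.
  under eq_bigr => b _ do rewrite H.
  rewrite big_split /= -mulr_sumr sumB.
  rewrite (sum_pred1_mul i (fun=> F i - F a)).
  over.
rewrite big_split /= sumB (sum_pred1_mul i (fun=> _)).
by ring.
Qed.

Lemma sum_tperm2 (G : 'I_n -> 'I_n -> R) i j : i != j ->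
  \sum_a \sum_b (G i j - G (tperm a b i) (tperm a b j)) =
  2 * ((2 * n%:R - 1) * G i j - G j i + G i i + G j j
       - \sum_a G a j - \sum_a G i a).
Proof.
move=> nij.
have nji : j != i by rewrite eq_sym.
(* Treating the moves of [i] and of [j] separately is wrong only for the swap of [i] with [j]
   itself; [C] is the correction for that swap. *)
pose C := G i i + G j j - G i j - G j i.
have H a b : G i j - G (tperm a b i) (tperm a b j) =
    (a == i)%:R * (G i j - G b j) + (b == i)%:R * (G i j - G a j)
    + (a == j)%:R * (G i j - G i b) + (b == j)%:R * (G i j - G i a)
    + (a == i)%:R * ((b == j)%:R * C) + (a == j)%:R * ((b == i)%:R * C).
  rewrite /C.
  case: (eqVneq a i) => [->|nai].
    rewrite tpermL (negPf nij).
    case: (eqVneq b j) => [->|nbj].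
      by rewrite tpermR (negPf nji) /=; ring.
    rewrite tpermD //.
    by case: (eqVneq b i) => [->|_] /=; ring.
  case: (eqVneq b i) => [->|nbi].
    rewrite tpermR (negPf nij).
    case: (eqVneq a j) => [->|naj].
      by rewrite tpermL /=; ring.
    by rewrite tpermD //=; ring.
  rewrite (tpermD (z := i)) //.
  case: (eqVneq a j) => [->|naj].
    rewrite tpermL; case: (eqVneq b j) => [->|_] /=; ring.
  case: (eqVneq b j) => [->|nbj].
    by rewrite tpermR /=; ring.
  by rewrite tpermD //=; ring.
have sum1 : \sum_b (G i j - G b j) = n%:R * G i j - \sum_a G a j.
  by rewrite sumrB sumr_const card_ord mulr_natl.
have sum2 : \sum_b (G i j - G i b) = n%:R * G i j - \sum_a G i a.
  by rewrite sumrB sumr_const card_ord mulr_natl.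
under eq_bigr => a _.
  under eq_bigr => b _ do rewrite H.
  rewrite !big_split /= -!mulr_sumr sum1 sum2.
  rewrite !(sum_pred1_mul _ (fun=> _)).
  over.
rewrite 5!big_split /= sum1 sum2 !(sum_pred1_mul _ (fun=> _)) /C.
by ring.
Qed.

(** * The Laplacian on Kronecker deltas and their products *)

Lemma sum_perm_eq x p : \sum_a (x a == p)%:R = 1 :> R.
Proof.
rewrite -[RHS](sum_pred1 p) [RHS](reindex_inj (@perm_inj _ x)) /=.
by apply: eq_bigr => a _; rewrite eq_sym.
Qed.

Let e i p x : R := (x i == p)%:R.

Lemma swap_laplacian_delta i p x :
  swap_laplacian (e i p) x = 2 * (n%:R * e i p x - 1).
Proof.
rewrite -[X in _ - X](sum_perm_eq x p) -(sum_tperm1 (fun a => (x a == p)%:R)).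
by do 2![apply: eq_bigr => ? _]; rewrite /e permM.
Qed.

Lemma shifted_eigen_delta i p : (0 < n)%N -> shifted_eigen n%:R (e i p).
Proof.
move=> n0; exists n%:R^-1 => x; rewrite swap_laplacian_delta.
by field; rewrite pnatr_eq0 -lt0n.
Qed.

(** In [sum_tperm2] the diagonal terms vanish because [p != q], and the row and column sums collapse
    to single deltas because [x] takes each value exactly once. *)
Lemma swap_laplacian_delta2 i j p q x : i != j -> p != q ->
  swap_laplacian (fun y => e i p y * e j q y) x =
  2 * ((2 * n%:R - 1) * (e i p x * e j q x) - e i q x * e j p x
       - e i p x - e j q x).
Proof.
move=> nij npq.
pose G a b : R := (x a == p)%:R * (x b == q)%:R.
have G0 a : G a a = 0.
  by rewrite /G; case: eqP => [->|]; rewrite ?(negPf npq) ?mulr0 ?mul0r.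
have -> : swap_laplacian (fun y => e i p y * e j q y) x =
    \sum_a \sum_b (G i j - G (tperm a b i) (tperm a b j)).
  by do 2![apply: eq_bigr => ? _]; rewrite /e !permM.
rewrite sum_tperm2 // !G0 /G -mulr_suml -mulr_sumr !sum_perm_eq /e.
by ring.
Qed.

(** For [n = 2] the values [p] and [q] exhaust ['I_n]. *)
Lemma sum_delta2 i p q x : n = 2%N -> p != q -> e i p x + e i q x = 1.
Proof.
move=> n2 npq.
have pqT : [set p; q] = setT.
  by apply/eqP; rewrite eqEcard subsetT cardsT card_ord cards2 npq n2.
rewrite -[RHS](sum_pred1 (x i)) [RHS](eq_bigl [in [set p; q]]); last first.
  by move=> a; rewrite pqT inE.
by rewrite big_setU1 ?inE //= big_set1.
Qed.

(** With [A = E - E'] and [U] the signed sum of deltas, [D A = 2 (2n A - U)] and [D U = 2n U], so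
    [A - U / n] has eigenvalue [4n], with shift 0. *)
Lemma shifted_eigen_antisym i j p q : (0 < n)%N -> i != j -> p != q ->
  shifted_eigen (2 * n%:R) (fun x => e i p x * e j q x + -1 * (e i q x * e j p x)
    + - n%:R^-1 * (e i p x + e j q x + -1 * (e i q x + e j p x))).
Proof.
move=> n0 nij npq; exists 0 => x.
have nqp : q != p by rewrite eq_sym.
rewrite !(swap_laplacianD, swap_laplacianZ) !swap_laplacian_delta2 //.
rewrite !swap_laplacian_delta.
by field; rewrite pnatr_eq0 -lt0n.
Qed.

(* For [n = 2] the correction vanishes, as [(n - 2)^-1 = 0], and the four
   deltas add up to the constant [2]. *)
Lemma shifted_eigen_sym i j p q : (2 <= n)%N -> i != j -> p != q ->
  shifted_eigen (2 * (n%:R - 1)) (fun x => e i p x * e j q x + e i q x * e j p x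
    + - (n%:R - 2)^-1 * (e i p x + e j q x + (e i q x + e j p x))).
Proof.
move=> n2 nij npq.
have nqp : q != p by rewrite eq_sym.
case: (eqVneq n 2%N) => [n_eq2|n_neq2].
  exists 1 => x.
  rewrite !(swap_laplacianD, swap_laplacianZ) !swap_laplacian_delta2 //.
  have := sum_delta2 i x n_eq2 npq; have := sum_delta2 j x n_eq2 npq.
  have -> : n%:R = 2 :> R by rewrite [in LHS]n_eq2.
  rewrite subrr invr0 oppr0 !mul0r !addr0.
  move=> /(canRL (addrK _)) -> /(canRL (addrK _)) ->.
  by ring.
have nr2 : n%:R - 2 != 0 :> R by rewrite subr_eq0 eqr_nat.
have nr1 : n%:R - 1 != 0 :> R by rewrite subr_eq0 pnatr_eq1 gtn_eqF.
(* The four deltas leave the constant [8 / (n - 2)], which must equal [- 4 (n - 1) c]. *)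
exists (- 2 / ((n%:R - 1) * (n%:R - 2))) => x.
rewrite !(swap_laplacianD, swap_laplacianZ) !swap_laplacian_delta2 //.
rewrite !swap_laplacian_delta.
by field; apply/andP.
Qed.

(** * Decomposition into three eigenfunctions, closed under linear combinations *)

Definition three_eigen f := exists f1 f2 f3,
  [/\ forall x, f x = f1 x + f2 x + f3 x,
      shifted_eigen (2 * n%:R) f1,
      shifted_eigen (2 * (n%:R - 1)) f2 &
      shifted_eigen n%:R f3].

Lemma three_eigen0 : three_eigen (fun=> 0).
Proof.
by exists (fun=> 0), (fun=> 0), (fun=> 0); split=> [x|||];
  rewrite ?addr0 //; apply: shifted_eigen0.
Qed.

Lemma three_eigenD f g :
  three_eigen f -> three_eigen g -> three_eigen (fun x => f x + g x).
Proof.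
move=> [f1 [f2 [f3 [ef F1 F2 F3]]]] [g1 [g2 [g3 [eg G1 G2 G3]]]].
exists (fun x => f1 x + g1 x), (fun x => f2 x + g2 x), (fun x => f3 x + g3 x).
by split=> [x|||]; try exact: shifted_eigenD; rewrite ef eg; ring.
Qed.

Lemma three_eigenZ c f : three_eigen f -> three_eigen (fun x => c * f x).
Proof.
move=> [f1 [f2 [f3 [ef F1 F2 F3]]]].
exists (fun x => c * f1 x), (fun x => c * f2 x), (fun x => c * f3 x).
by split=> [x|||]; try exact: shifted_eigenZ; rewrite ef; ring.
Qed.

Lemma three_eigen_ext f g : f =1 g -> three_eigen f -> three_eigen g.
Proof.
move=> efg [f1 [f2 [f3 [ef F1 F2 F3]]]].
by exists f1, f2, f3; split=> // x; rewrite -efg.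
Qed.

Lemma three_eigen_sum (I : finType) (F : I -> 'S_n -> R) :
  (forall k, three_eigen (F k)) -> three_eigen (fun x => \sum_k F k x).
Proof.
move=> HF; elim: (index_enum I) => [|k s IHs].
  by apply: three_eigen_ext three_eigen0 => x; rewrite big_nil.
apply: three_eigen_ext (three_eigenD (HF k) IHs) => x.
by rewrite big_cons.
Qed.

Lemma three_eigen_delta2 i j p q : (2 <= n)%N ->
  three_eigen (fun x => e i p x * e j q x).
Proof.
move=> n2; have n0 : (0 < n)%N by apply: ltnW.
case: (eqVneq p q) => [<-|npq]; case: (eqVneq i j) => [<-|nij].
- exists (fun=> 0), (fun=> 0), (e i p).
  split; [|exact: shifted_eigen0|exact: shifted_eigen0|exact: shifted_eigen_delta].
  by move=> x; rewrite /e -natrM mulnb andbb !add0r.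
- apply: three_eigen_ext three_eigen0 => x; rewrite /e.
  case: eqP => [<-|]; rewrite ?mul0r // (inj_eq perm_inj) eq_sym.
  by rewrite (negPf nij) mulr0.
- apply: three_eigen_ext three_eigen0 => x; rewrite /e.
  by case: eqP => [->|]; rewrite ?mul0r // (negPf npq) mulr0.
(* [E] is half the sum of [E - E'] and [E + E']. The third function gives back both corrections;
   unification fills in all three. *)
do 3![eexists]; split; last first.
- apply: shifted_eigenD.
    apply: (shifted_eigenZ (2^-1 * n%:R^-1)); apply: shifted_eigenD.
      by apply: shifted_eigenD; [exact: (shifted_eigen_delta i p n0)
                                |exact: (shifted_eigen_delta j q n0)].
    apply: (shifted_eigenZ (-1)).
    by apply: shifted_eigenD; [exact: (shifted_eigen_delta i q n0)
                              |exact: (shifted_eigen_delta j p n0)].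
  apply: (shifted_eigenZ (2^-1 * (n%:R - 2)^-1)); apply: shifted_eigenD.
    by apply: shifted_eigenD; [exact: (shifted_eigen_delta i p n0)
                              |exact: (shifted_eigen_delta j q n0)].
  by apply: shifted_eigenD; [exact: (shifted_eigen_delta i q n0)
                            |exact: (shifted_eigen_delta j p n0)].
- exact: (shifted_eigenZ 2^-1 (shifted_eigen_sym n2 nij npq)).
- exact: (shifted_eigenZ 2^-1 (shifted_eigen_antisym n0 nij npq)).
(* The identity holds for arbitrary [u] and [v]; keeping them opaque avoids the condition
   [n != 2]. *)
move=> x /=; set u := n%:R^-1; set v := (_ - 2)^-1.
by field.
Qed.

End SwapLaplacian.

Theorem theorem1 (R : realType) (n : nat) (hn : (2 <= n)%N)
    (psi : 'I_n -> 'I_n -> 'I_n -> 'I_n -> R) :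
  exists f1 f2 f3 : 'S_n -> R,
    [/\ forall x : 'S_n, gqap_cost psi x = f1 x + f2 x + f3 x,
        elementary f1 (2 * n%:R),
        elementary f2 (2 * (n%:R - 1)) &
        elementary f3 n%:R].
Proof.
have [f1 [f2 [f3 [ef F1 F2 F3]]]] : three_eigen (gqap_cost psi).
  do 4![apply: three_eigen_sum => ?].
  apply: three_eigen_ext (three_eigenZ _ (three_eigen_delta2 R _ _ _ _ hn)) => x.
  by rewrite mulrA.
have n0 : n%:R != 0 :> R by rewrite pnatr_eq0 -lt0n ltnW.
have n1 : n%:R - 1 != 0 :> R by rewrite subr_eq0 pnatr_eq1 gtn_eqF.
have two0 : 2 != 0 :> R by rewrite pnatr_eq0.
exists f1, f2, f3.
by split; rewrite //; apply: elementary_shifted_eigen; rewrite ?mulf_neq0.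
Qed.
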